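(* Let the domain $\Omega$ be partitioned into elements $\Omega_e$, $e=1,\dots,N_e$, let $U$ be a DG solution with restrictions $U_e$ to $\Omega_e$ and element averages $\overline U_e$, and on each element let ${}^{\mathcal L}U_e=U_e+\varepsilon(\overline U_e-U_e)$, where $\varepsilon=\varepsilon_e\in[0,1]$ is a constant on the element. Let ${}^{\mathcal L}U$ be the function on $\Omega$ with restrictions ${}^{\mathcal L}U_e$. Then $$\|{}^{\mathcal L}U\|_\Omega^2\ \le\ \|U\|_\Omega^2 .$$
   Context: $\|\cdot\|_\Omega$ denotes the $L_2(\Omega)$ norm (of vector-valued functions). The domain $\Omega$ is periodic, $U_e$ is a (vector-valued) polynomial on $\Omega_e$, and $\overline U_e=\frac{1}{|\Omega_e|}\int_{\Omega_e}U_e\,dx$. The map $U\mapsto{}^{\mathcal L}U$ is the limiting operator; its parameter is $\varepsilon=\tau/(\tau-a)$ with $\tau\le0$ and $a>0$, hence $\varepsilon\in[0,1)$. *)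

(* Defs.v *)
From HB Require Import structures.
From mathcomp Require Import all_boot all_order all_algebra.
From mathcomp Require mpoly.
From mathcomp Require Import all_classical all_reals all_analysis.

Set Implicit Arguments.
Unset Strict Implicit.
Unset Printing Implicit Defensive.
Import Order.TTheory GRing.Theory Num.Theory.
Import numFieldNormedType.Exports.

Local Open Scope classical_set_scope.
Local Open Scope ring_scope.

(* Points of R^d: the sigma-algebra on tuples is the product of the Borel
   ones. *)
Notation coords R d := (d.-tuple (measurableTypeR R)).

Definition cons_point (R : realType) (d : nat)
    (x : measurableTypeR R * coords R d) : coords R d.+1 :=
  [tuple of x.1 :: x.2].

Definition uncons_point (R : realType) (d : nat)
    (x : coords R d.+1) : measurableTypeR R * coords R d :=
  (thead x, [tuple of behead x]).

Lemma cons_pointK (R : realType) (d : nat) :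
  cancel (@cons_point R d) (@uncons_point R d).
Proof. by move=> [x t]; congr pair; apply: val_inj. Qed.

Lemma uncons_pointK (R : realType) (d : nat) :
  cancel (@uncons_point R d) (@cons_point R d).
Proof. by move=> t; rewrite [RHS]tuple_eta; apply: val_inj. Qed.

Lemma measurable_cons_point (R : realType) (d : nat) :
  measurable_fun setT (@cons_point R d).
Proof. exact: measurable_cons. Qed.

Lemma measurable_uncons_point (R : realType) (d : nat) :
  measurable_fun setT (@uncons_point R d).
Proof.
apply/measurable_fun_pairP; split; last exact: measurable_behead.
exact: measurable_tnth.
Qed.

HB.instance Definition _ (R : realType) (d : nat) :=
  isMeasurableFun.Build _ _ _ _ (@cons_point R d)
    (@measurable_cons_point R d).

Section lebesgue_cons.
Context (R : realType) (d : nat).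
Variable mu : {sigma_finite_measure set (coords R d) -> \bar R}.

Definition lebesgue_cons : set (coords R d.+1) -> \bar R :=
  pushforward (lebesgue_measure \x mu)%E (@cons_point R d).

Let lebesgue_cons0 : lebesgue_cons set0 = 0%E.
Proof. exact: measure0. Qed.

Let lebesgue_cons_ge0 A : (0 <= lebesgue_cons A)%E.
Proof. exact: measure_ge0. Qed.

Let lebesgue_cons_sigma_additive : semi_sigma_additive lebesgue_cons.
Proof. exact: measure_semi_sigma_additive. Qed.

HB.instance Definition _ := isMeasure.Build _ _ _ lebesgue_cons
  lebesgue_cons0 lebesgue_cons_ge0 lebesgue_cons_sigma_additive.

Let lebesgue_cons_sigma_finite : sigma_finite setT lebesgue_cons.
Proof.
have /sigma_finiteP[F [FT ndF Foo]] := sigma_finiteT (@lebesgue_measure R).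
have /sigma_finiteP[G [GT ndG Goo]] := sigma_finiteT mu.
exists (fun n => @uncons_point R d @^-1` (F n `*` G n)).
  rewrite -preimage_bigcup; apply/esym; rewrite -subTset => z _ /=.
  have [n _ Fn] : (\bigcup_i F i) (uncons_point z).1 by rewrite -FT.
  have [k _ Gk] : (\bigcup_i G i) (uncons_point z).2 by rewrite -GT.
  exists (maxn n k) => //; split.
  - by move: Fn; apply/subsetPset/ndF/leq_maxl.
  - by move: Gk; apply/subsetPset/ndG/leq_maxr.
move=> n; have [mF Fn] := Foo n; have [mG Gn] := Goo n; split.
  rewrite -[X in measurable X]setTI; apply: measurable_uncons_point => //.
  exact: measurableX.
rewrite /lebesgue_cons /pushforward -comp_preimage (_ : _ \o _ = id).
  by rewrite preimage_id product_measure1E// lte_mul_pinfty// ge0_fin_numE.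
by apply/funext => x; rewrite /= cons_pointK.
Qed.

HB.instance Definition _ := Measure_isSigmaFinite.Build _ _ _ lebesgue_cons
  lebesgue_cons_sigma_finite.

End lebesgue_cons.

(* Lebesgue measure on R^d, as the d-fold product of the one on R. *)
Fixpoint lebesgue (R : realType) (d : nat) :
    {sigma_finite_measure set (coords R d) -> \bar R} :=
  match d with
  | 0 => \d_([tuple] : coords R 0)
  | d'.+1 => lebesgue_cons (lebesgue R d')
  end.

Definition box (R : realType) (d : nat) (a b : 'I_d -> R) : set (coords R d) :=
  [set x | forall i, a i <= tnth x i <= b i].

Lemma measurable_box (R : realType) (d : nat) (a b : 'I_d -> R) :
  measurable (box a b).
Proof.
rewrite (_ : box a b =
    \bigcap_(i in [set: 'I_d]) ((fun x => tnth x i) @^-1` `[a i, b i])).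
  apply: fin_bigcap_measurable => // i _; rewrite -[X in measurable X]setTI.
  by apply: measurable_tnth => //; exact: measurable_itv.
by apply/seteqP; split=> x h i; have := h i; rewrite /= in_itv//; apply.
Qed.

Lemma lebesgue_box (R : realType) (d : nat) (a b : 'I_d -> R) :
  (forall i, a i <= b i) ->
  lebesgue R d (box a b) = (\prod_(i < d) (b i - a i))%:E.
Proof.
elim: d a b => [|d IHd] a b leab.
  rewrite big_ord0 /= diracE mem_set//; by case.
rewrite /= /lebesgue_cons /pushforward.
pose sh (f : 'I_d.+1 -> R) i := f (lift ord0 i).
rewrite (_ : _ @^-1` _ = `[a ord0, b ord0] `*` box (sh a) (sh b)); last first.
  apply/seteqP; split=> -[x t] /=.
    move=> h; split; first by rewrite in_itv /=; exact: (h ord0).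
    by move=> i; have := h (lift ord0 i); rewrite tnthS.
  rewrite in_itv /= => -[hx ht] i.
  by have [j ->|->] := unliftP ord0 i; [rewrite tnthS; exact: ht|].
rewrite product_measure1E//; last exact: measurable_box.
rewrite IHd; last by move=> i; exact: leab.
rewrite (_ : (_ `[_, _]%classic = (b ord0 - a ord0)%:E)%E); last first.
  apply: (etrans (lebesgue_measure_itv _)); rewrite /= lte_fin.
  have := leab ord0; rewrite le_eqVlt => /predU1P[->|->]; last by rewrite -EFinB.
  by rewrite ltxx subrr.
by rewrite big_ord_recl.
Qed.

(* [lattice_shift P x k] is x + k P: the rows of P are the periods. *)
Definition lattice_shift (R : realType) (d : nat) (P : 'M[R]_d)
    (x : coords R d) (k : 'I_d -> int) : coords R d :=
  [tuple tnth x i + \sum_(j < d) (k j)%:~R * P j i | i < d].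

(* A periodic domain, i.e. the torus R^d / (Z^d P), is represented by a
   fundamental cell: a set meeting each orbit of the period lattice in exactly
   one point.  The cell need not be a box, so that elements crossing the seam
   of the torus can be represented without being cut. *)
Definition periodic_domain (R : realType) (d : nat) (P : 'M[R]_d)
    (Omega : set (coords R d)) : Prop :=
  [/\ P \in unitmx, measurable Omega
    & forall x, exists! k : 'I_d -> int, Omega (lattice_shift P x k)].

Definition bounded_region (R : realType) (d : nat) (A : set (coords R d)) :
    Prop :=
  exists M : R, forall x, A x -> forall i, `|tnth x i| <= M.

(* The elements are only required to cover Omega up to a null set, so that
   they may be taken open. *)
Definition element_partition (R : realType) (d N : nat)
    (Omega : set (coords R d)) (K : 'I_N -> set (coords R d)) : Prop :=
  [/\ forall e, [/\ measurable (K e), bounded_region (K e),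
        K e `<=` Omega & (0 < lebesgue R d (K e))%E],
      trivIset setT K
    & lebesgue R d (Omega `\` \bigcup_e K e) = 0%E].

Definition polynomial_on (R : realType) (d m : nat) (A : set (coords R d))
    (U : coords R d -> 'rV[R]_m) : Prop :=
  exists p : 'I_m -> mpoly.mpoly d R,
    forall x, A x -> forall i, U x ord0 i = mpoly.meval (tnth x) (p i).

(* Different elements are unrelated: U may jump across interfaces. *)
Definition dg_function (R : realType) (d N m : nat)
    (Omega : set (coords R d)) (K : 'I_N -> set (coords R d))
    (U : coords R d -> 'rV[R]_m) : Prop :=
  (forall i, measurable_fun Omega (fun x => U x ord0 i)) /\
  (forall e, polynomial_on (K e) U).

Definition average (R : realType) (d m : nat) (A : set (coords R d))
    (U : coords R d -> 'rV[R]_m) : 'rV[R]_m :=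
  \row_i ((fine (lebesgue R d A))^-1 *
          \int[lebesgue R d]_(x in A) U x ord0 i).

(* The null set of points of Omega outside all elements is left untouched. *)
Definition limited (R : realType) (d N m : nat) (K : 'I_N -> set (coords R d))
    (eps : 'I_N -> R) (U : coords R d -> 'rV[R]_m) :
    coords R d -> 'rV[R]_m :=
  fun x => if [pick e | x \in K e] is Some e
           then U x + eps e *: (average (K e) U - U x)
           else U x.

(* The norm on matrices provided by the library is the sup norm. *)
Definition euclidean_norm (R : realType) (m : nat) (v : 'rV[R]_m) : R :=
  Num.sqrt (\sum_(i < m) v ord0 i ^+ 2).

Definition L2norm (R : realType) (d m : nat) (A : set (coords R d))
    (U : coords R d -> 'rV[R]_m) : \bar R :=
  'N[lebesgue R d]_(2%:E)[(fun x => (euclidean_norm (U x))%:E) \_ A].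

(* Main.v *)
Require Import Defs.
From mathcomp Require Import all_boot all_order all_algebra.
From mathcomp Require Import all_classical all_reals all_analysis.
From mathcomp Require Import measurable_realfun ring lra.
Import Order.TTheory GRing.Theory Num.Theory.
Local Open Scope classical_set_scope.
Local Open Scope ring_scope.

(** On an element with average [c], the limited value of [u] is
    [v = u + e (c - u)], and pointwise [v^2 + 2 e c (u - c) <= u^2] as soon as
    [0 <= e <= 1].  The linear term integrates to zero by the choice of [c],
    so limiting does not increase the integral of the square over any element;
    summing over components and elements gives the claim. *)

Lemma measurable_fun_fin_bigcup {d d'} {T : measurableType d}
    {T' : measurableType d'} {I : finType} {F : I -> set T} {f : T -> T'} :
  (forall i, measurable (F i)) -> (forall i, measurable_fun (F i) f) ->
  measurable_fun (\bigcup_i F i) f.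
Proof.
move=> mF mf _ Y mY; rewrite setI_bigcupl.
by apply: fin_bigcup_measurable => // i _; exact: mf.
Qed.

(** Nonnegativity and disjointness split both integrals into finite sums over the pieces, which are
    compared term by term. *)
Lemma ge0_le_integral_fin_bigcup d (T : measurableType d) (R : realType)
    (mu : {measure set T -> \bar R}) (I : finType) (F : I -> set T)
    (f g : T -> \bar R) :
  (forall i, measurable (F i)) -> trivIset setT F ->
  (forall x, 0 <= f x)%E -> (forall x, 0 <= g x)%E ->
  (forall i, measurable_fun (F i) f) -> (forall i, measurable_fun (F i) g) ->
  (forall i, \int[mu]_(x in F i) f x <= \int[mu]_(x in F i) g x)%E ->
  (\int[mu]_(x in \bigcup_i F i) f x <= \int[mu]_(x in \bigcup_i F i) g x)%E.
Proof.
move=> mF tF f0 g0 mf mg le_fg.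
have sT : [set: I] = [set` index_enum I].
  by apply/seteqP; split=> i //= _; rewrite mem_index_enum.
have mFf := measurable_fun_fin_bigcup mF mf.
have mFg := measurable_fun_fin_bigcup mF mg.
move: mFf mFg tF; rewrite sT bigcup_seq => mFf mFg tF.
rewrite !ge0_integral_bigsetU ?index_enum_uniq//.
by apply: lee_sum => i _; exact: le_fg.
Qed.

Lemma integral_sqr_relax_average_le d (T : measurableType d) (R : realType)
    (mu : {measure set T -> \bar R}) (A : set T) (u : T -> R) (e c : R) :
  measurable A -> (0 < mu A < +oo)%E -> measurable_fun A u -> 0 <= e <= 1 ->
  c = (fine (mu A))^-1 * \int[mu]_(x in A) u x ->
  (\int[mu]_(x in A) ((u x + e * (c - u x)) ^+ 2)%:E <=
   \int[mu]_(x in A) (u x ^+ 2)%:E)%E.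
Proof.
move=> mA /andP[mu_gt0 mu_fin] mfu /andP[e0 e1] cE.
set v := fun x => u x + e * (c - u x).
have mv : measurable_fun A v.
  by apply: measurable_funD => //; apply: measurable_funM => //;
     exact: measurable_funB.
have mv2 : measurable_fun A (fun x => (v x ^+ 2)%:E).
  by apply/measurable_EFinP; exact: measurable_funX.
have mu2 : measurable_fun A (fun x => (u x ^+ 2)%:E).
  by apply/measurable_EFinP; exact: measurable_funX.
(* If the right-hand side is infinite the bound is trivial; otherwise [u] is square-integrable on
   [A]. *)
have [u2oo|] := ltP (\int[mu]_(x in A) (u x ^+ 2)%:E)%E +oo%E; last first.
  by rewrite leye_eq => /eqP ->; rewrite leey.
have iu2 : mu.-integrable A (fun x => (u x ^+ 2)%:E).
  apply/integrableP; split=> //.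
  by under eq_integral do rewrite gee0_abs ?lee_fin ?sqr_ge0//.
have icst k : mu.-integrable A (EFin \o cst k).
  apply/integrableP; split; first exact/measurable_EFinP.
  by rewrite (integral_cst mu mA `|k|%:E) lte_mul_pinfty.
(* Domination by [1 + u^2], integrable because [A] has finite measure. *)
have iu : mu.-integrable A (EFin \o u).
  apply: (@le_integrable _ _ _ _ _ mA _ (fun x => 1%:E + (u x ^+ 2)%:E)%E).
  - exact/measurable_EFinP.
  - move=> x _; rewrite -EFinD !abse_EFin lee_fin [leRHS]ger0_norm; last first.
      by rewrite addr_ge0// sqr_ge0.
    by rewrite ler_norml; apply/andP; split; nra.
  - exact: (integrableD mA (icst 1) iu2).
have iw : mu.-integrable A (EFin \o (fun x => u x - c)).
  exact: (integrableB mA iu (icst c)).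
(* Since [mu A] is finite and nonzero, the factor [mu A] from integrating the constant [c] cancels
   the inverse in [cE]. *)
have w0 : (\int[mu]_(x in A) (u x - c)%:E = 0)%E.
  rewrite (integralB_EFin mA iu (icst c)) (integral_cst mu mA c%:E).
  rewrite -[X in (X - _)%E]fineK ?integrable_fin_num//.
  rewrite -[mu A]fineK ?ge0_fin_numE// -EFinM -EFinB cE /Rintegral/=.
  by rewrite mulrAC mulVf ?mul1r ?subrr// gt_eqF// fine_gt0// mu_gt0.
pose k := 2 * e * c.
have ikw : mu.-integrable A (fun x => k%:E * (u x - c)%:E)%E.
  exact: integrableZl.
(* The gap is exactly [e (2 - e) (u - c)^2], nonnegative for [e] in [[0, 1]]. *)
have le_v x : (v x ^+ 2 + k * (u x - c) <= u x ^+ 2).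
  rewrite -subr_ge0 (_ : _ - _ = e * (2 - e) * (u x - c) ^+ 2).
    by rewrite mulr_ge0 ?sqr_ge0// mulr_ge0//; lra.
  by rewrite /v /k; ring.
(* By [le_v], [v^2] is dominated by an integrable function; this permits splitting the integral of
   [v^2 + k (u - c)] below. *)
have iv2 : mu.-integrable A (fun x => (v x ^+ 2)%:E).
  apply: (@le_integrable _ _ _ _ _ mA _
    (fun x => (u x ^+ 2)%:E - k%:E * (u x - c)%:E)%E) => //.
  - move=> x _; rewrite -EFinM -EFinB /= lee_fin.
    have := le_v x; rewrite -lerBrDr ger0_norm ?sqr_ge0// => h.
    by rewrite (le_trans h)// ler_norm.
  - exact: integrableB.
have -> : (\int[mu]_(x in A) (v x ^+ 2)%:E =
    \int[mu]_(x in A) ((v x ^+ 2)%:E + k%:E * (u x - c)%:E))%E.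
  by rewrite integralD// integralZl// w0 mule0 adde0.
apply: le_integral => //; first exact: integrableD.
by move=> x _; rewrite -EFinM -EFinD lee_fin.
Qed.

(** The region lies in a cube, whose volume is a finite product. *)
Lemma lebesgue_bounded_region_fin (R : realType) (d : nat)
    (A : set (coords R d)) :
  measurable A -> bounded_region A -> (lebesgue R d A < +oo)%E.
Proof.
(* The bound [M] may be negative, for instance when [A] is empty; its absolute value keeps the ends
   of the box in order. *)
move=> mA [M AM]; pose a (_ : 'I_d) := - `|M|; pose b (_ : 'I_d) := `|M|.
apply: (@le_lt_trans _ _ (lebesgue R d (box a b))).
  apply: le_measure; rewrite ?inE//; first exact: measurable_box.
  by move=> x Ax i; rewrite -ler_norml (le_trans (AM x Ax i))// ler_norm.
rewrite lebesgue_box ?ltry// => i.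
by rewrite (le_trans _ (normr_ge0 M))// oppr_le0.
Qed.

(** Squaring undoes the outer root of the norm, and the inner square undoes the Euclidean root; this
    also holds when the integral is infinite. *)
Lemma L2norm_sqr (R : realType) (d m : nat) (A : set (coords R d))
    (U : coords R d -> 'rV[R]_m) :
  (L2norm A U ^+ 2 =
   \int[lebesgue R d]_(x in A) (\sum_(i < m) U x ord0 i ^+ 2)%:E)%E.
Proof.
rewrite /L2norm Lnorm.unlock poweR12_sqrt; last first.
  by apply: integral_ge0 => x _; exact: poweR_ge0.
rewrite sqr_sqrte; last by apply: integral_ge0 => x _; exact: poweR_ge0.
rewrite [RHS]integral_mkcond; apply: eq_integral => x _.
rewrite !patchE; case: ifP => _ /=; last by rewrite normr0 powR0.
rewrite powR_mulrn// ger0_norm ?sqrtr_ge0// sqr_sqrtr//.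
by apply: sumr_ge0 => i _; exact: sqr_ge0.
Qed.

(** Disjointness forces the element found by [pick] to be [e]. *)
Lemma limited_in {R : realType} {d N m : nat} {K : 'I_N -> set (coords R d)}
    (eps : 'I_N -> R) (U : coords R d -> 'rV[R]_m) {e : 'I_N} {x : coords R d} :
  trivIset setT K -> K e x ->
  limited K eps U x = U x + eps e *: (average (K e) U - U x).
Proof.
move=> tK Kex; rewrite /limited; case: pickP => [e' /set_mem Ke'x|/(_ e)].
  by have <- : e' = e by apply: tK => //; exists x.
by rewrite mem_set.
Qed.

Lemma limited_out (R : realType) (d N m : nat) (K : 'I_N -> set (coords R d))
    (eps : 'I_N -> R) (U : coords R d -> 'rV[R]_m) (x : coords R d) :
  ~ (\bigcup_e K e) x -> limited K eps U x = U x.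
Proof.
move=> nKx; rewrite /limited; case: pickP => // e /set_mem Kex.
by case: nKx; exists e.
Qed.

Theorem mainTheorem4 (R : realType) (d N m : nat)
    (P : 'M[R]_d) (Omega : set (coords R d)) (K : 'I_N -> set (coords R d))
    (U : coords R d -> 'rV[R]_m) (eps : 'I_N -> R)
    (periodic_Omega : periodic_domain P Omega)
    (partition_K : element_partition Omega K)
    (dg_U : dg_function Omega K U)
    (eps01 : forall e, 0 <= eps e <= 1) :
  ((L2norm Omega (limited K eps U)) ^+ 2 <= (L2norm Omega U) ^+ 2)%E.
Proof.
case: periodic_Omega => _ mO _; case: partition_K => K_ tK _.
case: dg_U => mU _.
have mK e : measurable (K e) by case: (K_ e).
have KO e : K e `<=` Omega by case: (K_ e).
(* The part of [Omega] outside all elements becomes an extra piece [None], so that [F] partitions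
   [Omega] exactly. *)
pose F (o : option 'I_N) :=
  if o is Some e then K e else Omega `\` \bigcup_e K e.
have mF o : measurable (F o).
  case: o => [e|] //=; apply: measurableD => //.
  exact: fin_bigcup_measurable.
have FO o : F o `<=` Omega by case: o => [e|] //= x [].
have OF : Omega = \bigcup_o F o.
  apply/seteqP; split=> x; last by case=> o _ /FO.
  move=> Ox; have [[e _ Kex]|nK] := pselect ((\bigcup_e K e) x).
    by exists (Some e).
  by exists None.
have tF : trivIset setT F.
  move=> [e|] [e'|] _ _ //= [x []] => [Kx K'x|Kx [_ []]|[_ nK] Kx].
  - by congr Some; apply: tK => //; exists x.
  - by exists e.
  - by case: nK; exists e'.
have mUF o i : measurable_fun (F o) (fun x => U x ord0 i).
  exact: (measurable_funS mO (FO o) (mU i)).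
(* On each piece the limited function is affine in [U]: a relaxation to the average on an element,
   [U] itself on [None]. *)
have mLF o i : measurable_fun (F o) (fun x => limited K eps U x ord0 i).
  case: o => [e|] /=.
    apply: (@eq_measurable_fun _ _ _ _ _ (fun x =>
        U x ord0 i + eps e * (average (K e) U ord0 i - U x ord0 i))).
      by move=> x /set_mem Kx; rewrite (limited_in _ _ tK Kx) !mxE.
    have mUK := mUF (Some e) i; apply: measurable_funD => //.
    by apply: measurable_funM => //; exact: measurable_funB.
  apply: eq_measurable_fun (mUF None i).
  by move=> x /set_mem[_ nK]; rewrite limited_out.
have mS (V : coords R d -> 'rV[R]_m) o :
    (forall i, measurable_fun (F o) (fun x => V x ord0 i)) ->
    measurable_fun (F o) (fun x => (\sum_(i < m) V x ord0 i ^+ 2)%:E).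
  move=> mV; apply/measurable_EFinP; apply: measurable_sum => i.
  exact: measurable_funX.
have S0 (V : coords R d -> 'rV[R]_m) x :
    (0 <= (\sum_(i < m) V x ord0 i ^+ 2)%:E)%E.
  by rewrite lee_fin; apply: sumr_ge0 => i _; exact: sqr_ge0.
rewrite !L2norm_sqr OF; apply: ge0_le_integral_fin_bigcup => //.
- by move=> o; exact: mS.
- by move=> o; exact: mS.
case=> [e|] /=; last first.
  by under eq_integral => x /set_mem[_ nK] do rewrite limited_out//.
(* On an element, exchanging sum and integral reduces the claim to one scalar component at a
   time. *)
under eq_integral do rewrite -sumEFin.
under [leRHS]eq_integral do rewrite -sumEFin.
rewrite !ge0_integral_sum//; last 4 first.
- by move=> i; apply/measurable_EFinP/measurable_funX; exact: (mUF (Some e)).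
- by move=> i x _; rewrite lee_fin sqr_ge0.
- by move=> i; apply/measurable_EFinP/measurable_funX; exact: (mLF (Some e)).
- by move=> i x _; rewrite lee_fin sqr_ge0.
apply: lee_sum => i _.
under eq_integral => x /set_mem Kx do rewrite (limited_in _ _ tK Kx) !mxE.
have [_ bK _ K0] := K_ e.
apply: integral_sqr_relax_average_le => //; last exact: (mUF (Some e)).
by rewrite K0 lebesgue_bounded_region_fin.
Qed.
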